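(* Let $K$ be a Hausdorff locally compact abelian group. Then for every cardinal $\kappa$, every surjective continuous homomorphism $f: \mathbb{Z}^\kappa \to K$ is an open mapping. In particular, this is the case if $K$ is compact.
   Context: All topological groups are assumed Hausdorff and abelian. The group $\mathbb{Z}^\kappa$ carries the product (Tychonoff) topology, where $\mathbb{Z}$ is the discrete group of integers. *)

(* Defs.v *)
From HB Require Import structures.
From mathcomp Require Import all_boot all_algebra.
From mathcomp Require Import all_classical topology tvs.

Set Implicit Arguments.
Unset Strict Implicit.
Unset Printing Implicit Defensive.

Import GRing.Theory.

Local Open Scope classical_set_scope.
Local Open Scope ring_scope.

HB.instance Definition _ (M : zmodType) :=
  GRing.Zmodule.copy (discrete_topology M) M.

Lemma discrete_sub_continuous (M : zmodType) :
  continuous (fun x : discrete_topology M * discrete_topology M => x.1 - x.2).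
Proof.
move=> [x y] A /= /nbhs_singleton Axy.
exists ([set x], [set y]) => /=.
  by split; exact: discrete_set1.
by move=> [a b] /= [-> ->].
Qed.

HB.instance Definition _ (M : zmodType) :=
  PreTopologicalNmodule_isTopologicalZmodule.Build (discrete_topology M)
    (@discrete_sub_continuous M).

(* {ptws I -> M} is the power M^I with the Tychonoff topology; the group
   structure added here is the pointwise one. *)
HB.instance Definition _ (I : Type) (M : topologicalZmodType) :=
  GRing.Zmodule.copy {ptws I -> M} (I -> M).

Lemma ptws_sub_continuous (I : Type) (M : topologicalZmodType) :
  continuous (fun x : {ptws I -> M} * {ptws I -> M} => x.1 - x.2).
Proof.
move=> x; apply/cvg_sup => i; apply/cvg_image.
  by rewrite eqEsubset; split=> v // _; exists (cst v).
move=> A /= nA.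
have eval_continuous : continuous (fun g : {ptws I -> M} => g i).
  by move=> g; exact: (@proj_continuous {classic I} (fun=> M) i g).
have : (fun y : {ptws I -> M} * {ptws I -> M} => y.1 i - y.2 i) @ x
    --> x.1 i - x.2 i.
  apply: (@continuous2_cvg _ _ _ _ _ _ _ _ (fun a b : M => a - b)).
  - exact: (@sub_continuous M (x.1 i, x.2 i)).
  - exact: (cvg_comp _ (fun g : {ptws I -> M} => g i) cvg_fst
      (@eval_continuous x.1)).
  - exact: (cvg_comp _ (fun g : {ptws I -> M} => g i) cvg_snd
      (@eval_continuous x.2)).
move=> /(_ A nA) nB.
exists ((fun g : {ptws I -> M} => g i) @^-1` A) => //.
rewrite image_preimage // eqEsubset; split=> v // _; by exists (cst v).
Qed.

HB.instance Definition _ (I : Type) (M : topologicalZmodType) :=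
  PreTopologicalNmodule_isTopologicalZmodule.Build {ptws I -> M}
    (@ptws_sub_continuous I M).

Definition open_map (X Y : topologicalType) (f : X -> Y) : Prop :=
  forall U : set X, open U -> open (f @` U).

(* Main.v *)
Require Import Defs.
From HB Require Import structures.
From mathcomp Require Import all_boot all_algebra.
From mathcomp Require Import all_classical topology tvs.

Local Open Scope classical_set_scope.
Local Open Scope ring_scope.

Import GRing.Theory.

Set Implicit Arguments.
Unset Strict Implicit.
Unset Printing Implicit Defensive.

(** The power Z^I need not be metrizable, so the usual open mapping theorem
    does not apply; compactness replaces completeness as follows.

    For a finite list E of coordinates let U_E be the subgroup of the points of
    Z^I that vanish on E: these subgroups form a basis of neighbourhoods of 0.
    Let f : Z^I -> K be a continuous surjective homomorphism.  As K is locally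
    compact, the closure L of H = f(U_E) is compact as soon as E is large enough,
    and it suffices to show that H is then a neighbourhood of 0.

    Topologically, L is one, by Baire's theorem: U_E has countable index in Z^I,
    so countably many translates of the closed subgroup L cover K
    ([locally_compact_baire], [subgroup_countable_index_nbhs]).

    It remains to see that L = H.  Every integer is a multiple of m plus a
    remainder among 0, ..., m - 1, so U_E is contained in B + m U_E, where B is
    the part of U_E with coordinates in {0, ..., m - 1}, which is compact by
    Tychonoff's theorem.  Hence H is contained in f(B) + m L, which is compact,
    hence closed, hence contains L: thus L = H + m L for every m > 0
    ([closure_divisible]).  So L / H is a divisible subgroup of K / H, which is
    finitely generated, being a quotient of Z^E.  Such a subgroup is trivial
    ([divisible_sub_cyclic] for one generator, [divisible_sub_image] by
    induction on E). *)

(** * Baire's theorem in locally compact spaces *)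

(** The countable index type is arbitrary because the cosets below are naturally
    indexed by tuples of integers.  The proof shrinks nonempty open sets inside a
    compact neighbourhood, avoiding one member of the cover at each step. *)
Lemma locally_compact_baire (X : topologicalType) (T : countType)
    (F : T -> set X) :
  hausdorff_space X -> locally_compact [set: X] -> [set: X] !=set0 ->
  (forall t, closed (F t)) -> (forall x, exists t, F t x) ->
  exists t, (F t)° !=set0.
Proof.
move=> hX lX [x0 _] clF covF; apply: contrapT => noint.
have [W] := lX x0 I; rewrite withinET => Wx0 [cW _].
pose G n := oapp F set0 (unpickle n).
(* Out-of-range codes give the empty set, which is harmless to avoid. *)
have clG n : closed (G n).
  by rewrite /G; case: unpickle => [t|]; [exact: clF|exact: closed0].
have intG n V : open V -> V !=set0 -> V `\` G n !=set0.
  move=> oV [v Vv]; apply/set0P/eqP; rewrite setD_eq0 => VG; move: VG.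
  rewrite /G; case: unpickle => [t|] /= VF; last exact: (VF v).
  apply: noint; exists t, v; apply: (filterS VF).
  exact: open_nbhs_nbhs.
pose good V := [/\ open V, V !=set0 & V `<=` W].
have step (p : nat * set X) : exists V' : set X, good p.2 ->
    good V' /\ closure V' `<=` p.2 `\` G p.1.
  have [[oV V0 VW]|ngood] := pselect (good p.2); last by exists set0.
  have [v [Vv Gv]] := intG p.1 _ oV V0.
  have Wv : nbhs v W by apply: (filterS VW); exact: open_nbhs_nbhs.
  have Dv : nbhs v (p.2 `\` G p.1).
    apply: open_nbhs_nbhs; split => //.
    by apply: openI => //; exact: closed_openC.
  have [B Bv BD] := compact_regular hX cW Wv Dv.
  exists B° => _; split; first split.
  - exact: open_interior.
  - by exists v.
  - move=> y /interior_subset By; apply: VW.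
    by have [] : (p.2 `\` G p.1) y by apply: BD; exact: subset_closure.
  - by apply: subset_trans BD; apply: closureS; exact: interior_subset.
have [g gP] := choice step.
(* Each V n.+1 has its closure in V n and misses G n; by compactness of W the
   closures of all the V n have a common point. *)
pose fix V n := if n is m.+1 then g (m, V m) else W°.
have goodV n : good (V n).
  elim: n => [|n IH] /=; last by have [] := gP (n, V n) IH.
  split; [exact: open_interior|by exists x0|exact: interior_subset].
have VS n : closure (V n.+1) `<=` V n `\` G n by have [] := gP (n, V n) (goodV n).
have decV n m : V (n + m)%N `<=` V n.
  elim: m => [|m IH]; first by rewrite addn0.
  by rewrite addnS => y /subset_closure /VS [/IH].
have FF : ProperFilter (filter_from setT V).
  apply: filter_from_proper => [|n _]; last by have [] := goodV n.
  apply: filter_from_filter; first by exists 0%N.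
  move=> i j _ _; exists (i + j)%N => // y Vy; split; first exact: decV Vy.
  by move: Vy; rewrite addnC; exact: decV.
have [|p [_ clp]] := cW _ FF.
  by exists 0%N => //; exact: interior_subset.
have pV n : closure (V n) p by move=> B nB; apply: clp => //; exists n.
have [t Ftp] := covF p.
have [_] := VS _ _ (pV (pickle t).+1); apply.
by rewrite /G pickleK.
Qed.

(** * Divisible subgroups modulo a subgroup *)

Definition subgroup (V : zmodType) (H : set V) : Prop :=
  H 0 /\ forall x y, H x -> H y -> H (x - y).

Section Subgroup.
Context {V : zmodType} {H : set V}.
Hypothesis sgH : subgroup H.

Lemma subgroup0 : H 0. Proof. by case: sgH. Qed.

Lemma subgroupB x y : H x -> H y -> H (x - y).
Proof. by case: sgH => _; exact. Qed.

Lemma subgroupN x : H x -> H (- x).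
Proof. by move=> Hx; rewrite -sub0r; apply: subgroupB => //; exact: subgroup0. Qed.

Lemma subgroupD x y : H x -> H y -> H (x + y).
Proof. by move=> Hx Hy; rewrite -[y]opprK; apply: subgroupB => //; exact: subgroupN. Qed.

Lemma subgroupMz x (k : int) : H x -> H (x *~ k).
Proof.
have HMn n : H x -> H (x *+ n).
  move=> Hx; elim: n => [|n IH]; first by rewrite mulr0n; exact: subgroup0.
  by rewrite mulrS; exact: subgroupD.
by case: k => n Hx; [exact: HMn|apply: subgroupN; exact: HMn].
Qed.

(** A divisible subgroup of a cyclic group is trivial.  Here everything is
    considered modulo H, and the cyclic group is generated by a. *)
Lemma divisible_sub_cyclic (D : set V) (a : V) :
  (forall x, D x -> exists k : int, H (x - a *~ k)) ->
  (forall m x, D x -> exists2 y, D y & H (x - y *+ m.+1)) ->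
  D `<=` H.
Proof.
move=> Dcyc Ddiv x Dx.
(* If a has finite order modulo H, dividing by that order is enough. *)
have [[q Hqa]|noq] := pselect (exists q, H (a *+ q.+1)).
  have [y Dy Hxy] := Ddiv q _ Dx.
  have [t Hyt] := Dcyc _ Dy.
  rewrite (_ : x = (x - y *+ q.+1) + ((y - a *~ t) *~ q.+1 + a *+ q.+1 *~ t)).
    by do 2![apply: subgroupD => //]; exact: subgroupMz.
  have -> : a *+ q.+1 *~ t = a *~ t *~ q.+1.
    by rewrite pmulrn -!mulrzA mulrC.
  by rewrite -mulrzDl subrK -pmulrn subrK.
(* Otherwise a has infinite order modulo H, so the coefficient t of x is divisible
   by every positive integer; divisibility by |t| + 1 already forces t = 0. *)
have tor0 k : H (a *~ k) -> k = 0.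
  case: k => [[//|k]|k] Hk; first by case: noq; exists k.
  by case: noq; exists k; rewrite -[_ *+ _]opprK; exact: subgroupN.
have [t Hxt] := Dcyc _ Dx.
suff t0 : t = 0 by move: Hxt; rewrite t0 mulr0z subr0.
have [y Dy Hxy] := Ddiv `|t|%N _ Dx.
have [s Hys] := Dcyc _ Dy.
have /eqP : t - s * (`|t|.+1)%:Z = 0.
  apply: tor0.
  rewrite (_ : a *~ _ = (x - y *+ `|t|.+1) + (y - a *~ s) *~ `|t|.+1
                        - (x - a *~ t)).
    by apply: subgroupB => //; apply: subgroupD => //; exact: subgroupMz.
  by rewrite mulrzBl -pmulrn addrA subrK opprB [RHS]addrC addrA addrNK mulrzBr mulrzA.
rewrite subr_eq0 => /eqP ts.
have := congr1 absz ts; rewrite abszM absz_nat.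
case: (absz s) => [|n]; first by rewrite mul0n => /eqP; rewrite absz_eq0 => /eqP.
by rewrite mulSn => /eqP; rewrite addSn eqn_leq ltnNge leq_addr andbF.
Qed.

End Subgroup.

(** * Topological groups *)

Section TopologicalGroup.
Context {K : topologicalZmodType}.

Lemma addr_continuous (x : K) : continuous (fun y : K => y + x).
Proof.
move=> y; apply: (@continuous_comp _ _ _ (fun y => (y, x))
  (fun p : K * K => p.1 + p.2)); last exact: add_continuous.
by apply: cvg_pair; [exact: cvg_id|exact: cvg_cst].
Qed.

Lemma subr_nbhs (x : K) (A : set K) :
  nbhs (0 : K) A -> nbhs x [set y | A (y - x)].
Proof. by rewrite -(subrr x); exact: addr_continuous. Qed.

Lemma closure_subgroup (H : set K) : subgroup H -> subgroup (closure H).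
Proof.
move=> sgH; split; first by apply: subset_closure; exact: subgroup0 sgH.
move=> x y clx cly A nA.
have [[B C] /= [nB nC] BC] := @sub_continuous K (x, y) A nA.
have [h [Hh Bh]] := clx _ nB; have [k [Hk Ck]] := cly _ nC.
by exists (h - k); split; [exact: subgroupB sgH _ _ Hh Hk|exact: (BC (h, k))].
Qed.

(** Some translate of H has an interior point, by Baire; differences of points of
    that translate lie in H. *)
Lemma subgroup_countable_index_nbhs (H : set K) (T : countType) (g : T -> K) :
  hausdorff_space K -> locally_compact [set: K] ->
  subgroup H -> closed H -> (forall x, exists t, H (x - g t)) ->
  nbhs (0 : K) H.
Proof.
move=> hK lK sgH clH cov.
have [||t [x]] := @locally_compact_baire K T
  (fun t => (fun x => x - g t) @^-1` H) hK lK _ _ cov.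
- by exists (0 : K).
- move=> t; apply: (preimage_closed (f := fun x : K => x - g t)) => // x _.
  exact: addr_continuous.
move=> /= nx.
have nH : nbhs (0 : K) [set y | H (y + x - g t)].
  have := @addr_continuous x (0 : K); rewrite /continuous_at add0r => cx.
  exact: (cx _ nx).
have Hx : H (x - g t) by exact: (nbhs_singleton nx).
apply: (filterS _ nH) => y /= Hy.
rewrite (_ : y = (y + x - g t) - (x - g t)); first exact: subgroupB sgH _ _ Hy Hx.
by rewrite opprB addrA subrK addrK.
Qed.

Lemma natmul_continuous (m : nat) : continuous (fun x : K => x *+ m).
Proof.
elim: m => [|m IH]; first exact: cst_continuous.
have -> : (fun x : K => x *+ m.+1) = fun x => x + x *+ m.
  by apply/funext => y; rewrite mulrS.
move=> x; apply: (@continuous_comp _ _ _ (fun y : K => (y, y *+ m) : K * K)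
  (fun p : K * K => p.1 + p.2)); last exact: add_continuous.
by apply: cvg_pair; [exact: cvg_id|exact: IH].
Qed.

Lemma compact_sum (A B : set K) : compact A -> compact B ->
  compact [set p.1 + p.2 | p in A `*` B].
Proof.
move=> cA cB; apply: continuous_compact; last exact: compact_setX.
by apply: continuous_subspaceT => x; exact: add_continuous.
Qed.

End TopologicalGroup.

(** * Basic open subgroups of a power of the integers *)

Section IntPower.
Context {I : choiceType}.
Local Notation Z := (discrete_topology int).
Local Notation ZI := {ptws I -> Z}.

Definition vanish (E : seq I) : set ZI := [set x | forall i, i \in E -> x i = 0].

Lemma vanish_subgroup E : subgroup (vanish E).
Proof.
split=> [i //|x y x0 y0 i iE].
by rewrite -[LHS]/(x i - y i) x0// y0// subrr.
Qed.

(** The translates by x of the subgroups [vanish E] generate a filter, which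
    converges to x because it does so in each coordinate. *)
Lemma nbhs_vanish (x : ZI) (A : set ZI) : nbhs x A ->
  exists E, forall y, vanish E (y - x) -> A y.
Proof.
pose cylinder E : set ZI := [set y | vanish E (y - x)].
have cat_cylinder E1 E2 : cylinder (E1 ++ E2) `<=` cylinder E1 `&` cylinder E2.
  by move=> y vy; split=> i iE; apply: vy; rewrite mem_cat iE ?orbT.
have FF : Filter (filter_from setT cylinder).
  apply: filter_from_filter; first by exists [::].
  by move=> E1 E2 _ _; exists (E1 ++ E2).
suff : filter_from setT cylinder --> x by move=> /[apply] -[E _ EA]; exists E.
apply/cvg_sup => i; apply/cvg_image.
  by rewrite eqEsubset; split=> v // _; exists (cst v).
move=> B /= nB; exists ((fun y : ZI => y i) @^-1` B); last first.
  by rewrite image_preimage // eqEsubset; split=> v // _; exists (cst v).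
exists [:: i] => // y /(_ i); rewrite mem_head => /(_ isT) /eqP.
rewrite -[X in X == _]/(y i - x i) subr_eq0 => /eqP /= ->.
exact: nbhs_singleton nB.
Qed.

Definition unit_vector (i : I) : ZI := fun j => (i == j)%:R.

Lemma ptws_mulrz (x : ZI) (k : int) j : (x *~ k) j = x j *~ k.
Proof.
have nat n : (x *+ n) j = x j *+ n.
  by elim: n => [//|n IH]; rewrite !mulrS -IH.
by case: k => n; [exact: nat|rewrite -[LHS]/(- (x *+ n.+1) j) nat].
Qed.

(** Dropping a coordinate costs one cyclic summand, generated by the corresponding
    unit vector; this lets arguments about finite lists go by induction. *)
Lemma vanish_cons i E (x : ZI) :
  vanish E x -> vanish (i :: E) (x - unit_vector i *~ x i).
Proof.
move=> vx j; rewrite inE -[X in _ -> X = _]/(x j - (unit_vector i *~ x i) j).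
rewrite ptws_mulrz /unit_vector; have [->|ij] := eqVneq i j.
  by rewrite intz subrr.
by move=> /vx ->; rewrite mul0rz subrr.
Qed.

Lemma vanish_countable_index E :
  exists (T : countType) (g : T -> ZI), forall x, exists t, vanish E (x - g t).
Proof.
elim: E => [|i E [T [g gP]]]; first by exists unit, (fun=> 0) => x; exists tt.
exists (T * int)%type, (fun p => g p.1 + unit_vector i *~ p.2) => x.
have [t vt] := gP x; exists (t, (x - g t) i) => /=.
by rewrite opprD addrA; exact: vanish_cons.
Qed.

(** Euclidean division by m + 1 in each coordinate leaves a remainder in a power
    of a finite set, compact by Tychonoff's theorem. *)
Lemma vanish_box E m : exists2 B : set ZI, compact B &
  B `<=` vanish E /\
  forall x, vanish E x -> exists2 y, vanish E y & B (x - y *+ m.+1).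
Proof.
pose c i : set Z := if i \in E then [set 0] else
   (fun n : nat => n%:Z) @` `I_m.+1.
exists [set x : ZI | forall i, c i (x i)].
  apply: tychonoff => i; rewrite /c; case: ifP => _; apply: finite_compact.
    exact: finite_set1.
  by apply: finite_image; exact: finite_II.
split=> [x cx i iE|x vx]; first by have := cx i; rewrite /c iE.
exists (fun i => (x i %/ m.+1)%Z) => i; first by move=> /vx ->; rewrite div0z.
have ptws_mulrn (y : ZI) : (y *+ m.+1) i = y i *+ m.+1.
  by rewrite -[LHS]/((y *~ m.+1) i) ptws_mulrz.
rewrite -[X in c i X]/(x i - _ i) ptws_mulrn /c; case: ifP => [/vx ->|_] /=.
  by rewrite div0z mul0rn subrr.
have xm : (x i %% m.+1)%Z = x i - (x i %/ m.+1)%Z *+ m.+1.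
  by rewrite /modz -mulrzz.
exists (absz (x i %% m.+1)%Z).
  by rewrite /= -ltz_nat gez0_abs ?modz_ge0 ?ltz_pmod.
by rewrite gez0_abs ?modz_ge0.
Qed.

End IntPower.

(** * The open mapping property *)

Section OpenMapping.
Context {I : choiceType} {K : topologicalZmodType}.
Local Notation ZI := {ptws I -> discrete_topology int}.
Variable f : {additive ZI -> K}.
Hypotheses (K_hausdorff : hausdorff_space K) (f_cont : continuous f).

Lemma image_vanish_subgroup E : subgroup (f @` vanish E).
Proof.
have sg := @vanish_subgroup I E.
split; first by exists 0; [exact: subgroup0 sg|exact: raddf0].
move=> _ _ [x vx <-] [y vy <-]; exists (x - y); last exact: raddfB.
exact: subgroupB sg _ _ vx vy.
Qed.

(** With B the box of remainders modulo m + 1 and L the closure of the image H, the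
    set f(B) + (m + 1) L is compact, so it contains L because it contains H. *)
Lemma closure_divisible E : compact (closure (f @` vanish E)) ->
  forall m x, closure (f @` vanish E) x ->
  exists2 y, closure (f @` vanish E) y & (f @` vanish E) (x - y *+ m.+1).
Proof.
set H := f @` vanish E => cL m.
have [B cB [BE dE]] := @vanish_box I E m.
pose S := [set p.1 + p.2 | p in
  (f @` B) `*` ((fun y : K => y *+ m.+1) @` closure H)].
have cS : compact S.
  apply: compact_sum; apply: continuous_compact => //; apply: continuous_subspaceT.
    exact: f_cont.
  exact: natmul_continuous.
have HS : H `<=` S.
  move=> _ [x vx <-]; have [y vy Bxy] := dE _ vx.
  exists (f (x - y *+ m.+1), f y *+ m.+1) => /=.
    split; first by exists (x - y *+ m.+1).
    by exists (f y) => //; apply: subset_closure; exists y.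
  by rewrite raddfB raddfMn subrK.
move=> x; move/closureS: HS => /[apply].
rewrite -(closure_id _).1; last exact: compact_closed.
move=> [[_ _] [/= [b Bb <-] [y Ly <-]] <-]; exists y => //.
by rewrite addrK; exists b => //; exact: BE.
Qed.

Hypothesis f_surj : set_surj setT setT f.

(** K modulo the image of [vanish E] is generated by the images of the unit vectors
    at E, and the induction removes these generators one at a time. The hypothesis
    on D for a longer list implies the one for a shorter list, so the induction
    hypothesis already places D in the image for the shorter list. *)
Lemma divisible_sub_image (E : seq I) (D : set K) :
  (forall m x, D x -> exists2 y, D y & (f @` vanish E) (x - y *+ m.+1)) ->
  D `<=` f @` vanish E.
Proof.
elim: E => [_ x _|i E IH Ddiv].
  by have [y _ <-] := f_surj (Logic.I : setT x); exists y.
have DE : D `<=` f @` vanish E.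
  apply: IH => m x /(Ddiv m)[y Dy [z vz fz]]; exists y => //; exists z => // j jE.
  by apply: vz; rewrite inE jE orbT.
apply: (divisible_sub_cyclic (image_vanish_subgroup _) (a := f (unit_vector i)) _ Ddiv).
move=> _ /DE[x vx <-]; exists (x i), (x - unit_vector i *~ x i).
  exact: vanish_cons.
by rewrite raddfB raddfMz.
Qed.

Hypothesis K_lc : locally_compact [set: K].

(** The closure of the image is a neighbourhood of 0 because it has countable index
    in K, and divisibility identifies the image with its closure. *)
Lemma image_vanish_nbhs E :
  compact (closure (f @` vanish E)) -> nbhs (0 : K) (f @` vanish E).
Proof.
move=> cL; have LH := divisible_sub_image (closure_divisible cL).
apply: (filterS LH).
have [T [g gP]] := @vanish_countable_index I E.
apply: (@subgroup_countable_index_nbhs K _ T (f \o g)) => //.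
- by apply: closure_subgroup; exact: image_vanish_subgroup.
- exact: closed_closure.
move=> y; have [x _ <-] := f_surj (Logic.I : setT y); have [t vt] := gP x.
exists t; apply: subset_closure; exists (x - g t) => //; exact: raddfB.
Qed.

Lemma additive_open_map : open_map f.
Proof.
move=> O oO; rewrite openE => _ [x Ox <-]; rewrite /interior.
(* F makes the closure of the image compact, G keeps the translate inside O. *)
have [W] := K_lc (Logic.I : setT (0 : K)); rewrite withinET => W0 [cW clW].
have [F FW] : exists F, forall y, vanish F (y - 0) -> W (f y).
  by apply: nbhs_vanish; apply: f_cont; rewrite raddf0.
have [G GO] : exists G, forall y, vanish G (y - x) -> O y.
  by apply: nbhs_vanish; exact: open_nbhs_nbhs.
have HW : f @` vanish (F ++ G) `<=` W.
  move=> _ [y vy <-]; apply: FW => i iF; rewrite subr0; apply: vy.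
  by rewrite mem_cat iF.
have cL : compact (closure (f @` vanish (F ++ G))).
  apply: (subclosed_compact _ cW); first exact: closed_closure.
  by rewrite (closure_id W).1//; exact: closureS.
apply: filterS (subr_nbhs _ (image_vanish_nbhs cL)) => y [z vz zy].
exists (z + x); last by rewrite raddfD zy subrK.
by apply: GO; rewrite addrK => i iG; apply: vz; rewrite mem_cat iG orbT.
Qed.

End OpenMapping.

Unset Implicit Arguments.

Theorem corollary7 (K : topologicalZmodType) (K_hausdorff : hausdorff_space K) :
  (locally_compact [set: K] ->
     forall (I : Type) (f : {additive {ptws I -> discrete_topology int} -> K}),
       continuous f -> set_surj setT setT f -> open_map f) /\
  (compact [set: K] ->
     forall (I : Type) (f : {additive {ptws I -> discrete_topology int} -> K}),
       continuous f -> set_surj setT setT f -> open_map f).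
Proof.
have lc_case : locally_compact [set: K] ->
    forall (I : Type) (f : {additive {ptws I -> discrete_topology int} -> K}),
    continuous f -> set_surj setT setT f -> open_map f.
  move=> K_lc I f f_cont f_surj.
  (* Classical choice gives any type of coordinates a [choiceType] structure. *)
  exact: (@additive_open_map {classic I} K f).
split=> // K_compact; apply: lc_case => x _; rewrite withinET.
by exists setT; [exact: filterT|split=> //; exact: closedT].
Qed.
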